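(* Let $p$ be an odd prime, $a\in\mathbb{Z}_p$, and suppose $\langle a\rangle_p$ is odd. Then $$\sum_{k=0}^{p-1}\binom ak^2(-1)^k\equiv (-1)^{\frac{p-\langle a\rangle_p}{2}-1}\frac{2(a-\langle a\rangle_p)}{a\binom{p-\langle a\rangle_p}{(p-\langle a\rangle_p)/2}}\pmod{p^2}.$$
   Context: $\mathbb{Z}_p$ denotes the set of rational numbers whose denominator is not divisible by $p$; congruences are taken in $\mathbb{Z}_p$. For $a\in\mathbb{Z}_p$, $\langle a\rangle_p$ is the unique integer in $\{0,1,\dots,p-1\}$ with $a\equiv\langle a\rangle_p\pmod p$. The general binomial coefficient is $\binom a0=1$, $\binom ak=a(a-1)\cdots(a-k+1)/k!$ for $k\ge1$. *)

(* Defs.v *)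
From mathcomp Require Import all_boot all_order all_algebra ring.
Set Implicit Arguments.
Unset Strict Implicit.
Unset Printing Implicit Defensive.
Import Order.TTheory GRing.Theory Num.Theory.
Local Open Scope ring_scope.

(* Rationals whose denominator is not divisible by p (a subring of rat, not   *)
(* the p-adic completion). *)
Definition Zloc (p : nat) : {pred rat} := fun x => ~~ (p%:Z %| denq x)%Z.

(* Congruence in Zloc p: x - y lies in the ideal generated by m. Division by  *)
(* m makes this boolean; it is only meaningful for m > 0, see congrZlocP. *)
Definition congrZloc (p m : nat) (x y : rat) : bool :=
  (x - y) / m%:R \in Zloc p.

Lemma congrZlocP (p m : nat) (x y : rat) : (0 < m)%N ->
  reflect (exists2 z, z \in Zloc p & x - y = m%:R * z) (congrZloc p m x y).
Proof.
move=> m_gt0; have m_neq0 : m%:R != 0 :> rat by rewrite pnatr_eq0 -lt0n.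
apply: (iffP idP) => [xy|[z zZ exy]].
  by exists ((x - y) / m%:R) => //; rewrite mulrC divfK.
by rewrite /congrZloc exy mulrAC divff // mul1r.
Qed.

(* The default value 0 is never used when p is prime and a \in Zloc p, see    *)
(* residueP. *)
Definition residue (p : nat) (a : rat) : nat :=
  if [pick r : 'I_p | congrZloc p p a (r : nat)%:R] is Some r then r else 0%N.

Definition gbin (a : rat) (k : nat) : rat :=
  (\prod_(i < k) (a - i%:R)) / k`!%:R.

Lemma dvd_denq_Zloc (p : nat) (n d : int) :
  prime p -> ~~ (p%:Z %| d)%Z -> n%:~R / d%:~R \in Zloc p.
Proof.
move=> pr_p pNd; have d0 : d != 0 by apply: contraNneq pNd => ->; apply: dvdz0.
rewrite unfold_in /=; apply: contra pNd => /dvdz_trans; apply.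
set x := n%:~R / d%:~R.
have E : numq x * d = n * denq x.
  apply/eqP; rewrite -(eqr_int rat) !rmorphM /=; apply/eqP.
  have dq0 : d%:~R != 0 :> rat by rewrite intr_eq0.
  have -> : (numq x)%:~R = x * (denq x)%:~R.
    by rewrite -{2}[x]divq_num_den divfK // intr_eq0 denq_neq0.
  by rewrite mulrAC /x divfK.
rewrite -(@Gauss_dvdzr (denq x) (numq x)).
  by rewrite E dvdz_mull.
by rewrite /coprimez gcdzC; have := coprime_num_den x; rewrite /coprime /gcdz => /eqP ->.
Qed.

Lemma congrZloc_num (p : nat) (a : rat) (r : nat) : prime p -> a \in Zloc p ->
  congrZloc p p a r%:R = (p%:Z %| numq a - r%:Z * denq a)%Z.
Proof.
move=> pr_p aZ; have p0 : p%:R != 0 :> rat by rewrite pnatr_eq0 -lt0n prime_gt0.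
have d0 : (denq a)%:~R != 0 :> rat by rewrite intr_eq0 denq_neq0.
have Ea : a - r%:R = (numq a - r%:Z * denq a)%:~R / (denq a)%:~R.
  by rewrite rmorphB rmorphM /= mulrBl divq_num_den mulfK.
apply/idP/dvdzP => [xZ|[q Eq]].
  set x := (a - r%:R) / p%:R in xZ *; rewrite -/x in xZ.
  have dx0 : (denq x)%:~R != 0 :> rat by rewrite intr_eq0 denq_neq0.
  have E : (numq a - r%:Z * denq a) * denq x = denq a * numq x * p%:Z.
    apply/eqP; rewrite -(eqr_int rat) 3!rmorphM /=; apply/eqP.
    have -> : (numq x)%:~R = x * (denq x)%:~R.
      by rewrite -{2}[x]divq_num_den divfK.
    have -> : (numq a - r%:Z * denq a)%:~R = x * p%:R * (denq a)%:~R.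
      by rewrite /x divfK // Ea divfK.
    by rewrite -[p%:~R]/(p%:R); ring.
  apply/dvdzP; rewrite -(@Gauss_dvdzl _ _ (denq x)) ?E ?dvdz_mull //.
  by rewrite coprimezE prime_coprime.
rewrite /congrZloc Ea Eq rmorphM /= mulrAC mulfK //.
exact: dvd_denq_Zloc.
Qed.

Lemma residueP (p : nat) (a : rat) : prime p -> a \in Zloc p ->
  [/\ (residue p a < p)%N, congrZloc p p a (residue p a)%:R
    & forall r : nat, (r < p)%N -> congrZloc p p a r%:R -> r = residue p a].
Proof.
move=> pr_p aZ; have p_gt0 := prime_gt0 pr_p.
have cop : coprimez p%:Z (denq a).
  by rewrite coprimezE prime_coprime.
have uniq_r (r s : nat) : (r < p)%N -> (s < p)%N ->
    congrZloc p p a r%:R -> congrZloc p p a s%:R -> r = s.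
  move=> rp sp; rewrite !congrZloc_num // => pr ps.
  have := rpredB ps pr.
  have -> : numq a - s%:Z * denq a - (numq a - r%:Z * denq a)
      = (r%:Z - s%:Z) * denq a by ring.
  rewrite Gauss_dvdzl // -eqz_mod_dvd => /eqP.
  by rewrite !modz_nat !modn_small // => -[].
rewrite /residue; case: pickP => [r ar|none].
  by split=> // s sp as_; apply: uniq_r => //.
exfalso; case/coprimezP: cop => -[u v] /= uv.
have r_ge0 : (0 <= (numq a * v) %% p)%Z by rewrite modz_ge0 // eqz_nat -lt0n.
have r_ltp : (`|((numq a * v) %% p)%Z| < p)%N.
  by rewrite -ltz_nat gez0_abs // ltz_pmod.
set r := `|((numq a * v) %% p)%Z|%N in r_ltp.
suff ar : congrZloc p p a r%:R.
  by move: (none (Ordinal r_ltp)); rewrite [X in X = _]ar.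
rewrite congrZloc_num // /r gez0_abs //.
have -> : ((numq a * v) %% p)%Z = numq a * v - ((numq a * v) %/ p)%Z * p%:Z.
  by rewrite [X in _ = X - _](divz_eq _ p%:Z) addrAC subrr add0r.
apply/dvdzP; exists (numq a * u + ((numq a * v) %/ p)%Z * denq a).
by rewrite -[X in X - _ = _]mulr1 -uv; ring.
Qed.

(* Main.v *)
(** Write S(a) for the sum.  Zeilberger's algorithm gives
      (x - 1) (x S(x) + 4 (x - 1) S(x - 2)) = - binom(x - 1, p - 1)^2 q(x, p),
    where q is a polynomial.  If x is congruent modulo p to neither 0 nor 1,
    the right-hand side vanishes modulo p^2, so S(x - 2) is determined by S(x).
    Starting from x divisible by p, where S(x) and binom(x - 1, p - 1) are 1
    modulo p, one descends by steps of 2 to every a with odd residue; the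
    central binomial coefficient accumulates from the factors of the
    recurrence. *)
Require Import Defs.
From HB Require Import structures.
From mathcomp Require Import all_boot all_order all_algebra.
From mathcomp Require Import ring zify.
Set Implicit Arguments.
Unset Strict Implicit.
Unset Printing Implicit Defensive.
Import Order.TTheory GRing.Theory Num.Theory.
Local Open Scope ring_scope.

(** * Generalised binomial coefficients and the recurrence for the sum *)

Lemma gbin0 x : gbin x 0 = 1.
Proof. by rewrite /gbin big_ord0 fact0 divr1. Qed.

Lemma gbinSr x k : gbin x k.+1 = gbin x k * (x - k%:R) / k.+1%:R.
Proof. by rewrite /gbin big_ord_recr /= factS natrM invfM; ring. Qed.

Lemma gbinSl x k : gbin x k.+1 = x / k.+1%:R * gbin (x - 1) k.
Proof.
elim: k => [|k IHk]; first by rewrite gbinSr !gbin0 subr0; ring.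
rewrite gbinSr {}IHk [in RHS]gbinSr -!nat1r; field.
by rewrite !nat1r !pnatr_eq0.
Qed.

Lemma gbin_shift x k : x * gbin (x - 1) k = gbin x k * (x - k%:R).
Proof.
have k0 : k.+1%:R != 0 :> rat by rewrite pnatr_eq0.
apply: (mulIf (invr_neq0 k0)); rewrite -gbinSr gbinSl; ring.
Qed.

Lemma gbin_pascal x k : gbin x k.+1 = gbin (x - 1) k.+1 + gbin (x - 1) k.
Proof.
have k0 : 1 + k%:R != 0 :> rat by rewrite nat1r pnatr_eq0.
by rewrite gbinSl gbinSr -nat1r; field.
Qed.

Definition alt_gbin_sum (n : nat) (x : rat) : rat :=
  \sum_(0 <= k < n) gbin x k ^+ 2 * (-1) ^+ k.

(** The polynomial [q] of the recurrence; [y] stands for the number of summands. *)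
Definition zeil_cert (x y : rat) : rat :=
  - 2 * y ^+ 2 + (6 * x - 2) * y - 5 * x ^+ 2 + 3 * x.

(** The identity holds for every truncation, so induction on [n] applies: once the last summands are
    expressed through [gbin (x - 1) n], the step is an identity of rational functions. *)
Lemma zeilberger_recurrence n x :
  (x - 1) * (x * alt_gbin_sum n.+1 x
             + 4 * (x - 1) * alt_gbin_sum n.+1 (x - 2)) =
  (-1) ^+ n.+1 * gbin (x - 1) n ^+ 2 * zeil_cert x n.+1%:R.
Proof.
rewrite /alt_gbin_sum; elim: n => [|n IHn].
  by rewrite !big_nat1 !gbin0 /zeil_cert; ring.
rewrite big_nat_recr //= [X in _ + _ * X]big_nat_recr //=.
have n0 : 1 + n%:R != 0 :> rat by rewrite nat1r pnatr_eq0.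
(* The new summand at [x - 2] carries the coefficient [(x - 1) ^+ 2], which is absorbed into the
   square, so [x = 1] needs no separate case. *)
have e2 : (x - 1) * gbin (x - 2) n.+1 =
    gbin (x - 1) n * (x - 1 - n%:R) * (x - 2 - n%:R) / n.+1%:R.
  have -> : x - 2 = x - 1 - 1 by ring.
  rewrite gbin_shift gbinSr -nat1r; field.
  by [].
transitivity ((x - 1) * (x * (\sum_(0 <= k < n.+1) gbin x k ^+ 2 * (-1) ^+ k)
    + 4 * (x - 1) * (\sum_(0 <= k < n.+1) gbin (x - 2) k ^+ 2 * (-1) ^+ k))
  + (-1) ^+ n.+1 * ((x - 1) * x * gbin x n.+1 ^+ 2
       + 4 * ((x - 1) * gbin (x - 2) n.+1) ^+ 2)); first by ring.
rewrite IHn e2 gbinSl gbinSr /zeil_cert !exprS -!nat1r; field.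
by [].
Qed.

(** This ratio of consecutive central binomial coefficients is what each step of the descent
    contributes. *)
Lemma central_bin n :
  (n.+1 * 'C(n.+1.*2, n.+1) = 2 * (n.*2.+1 * 'C(n.*2, n)))%N.
Proof.
rewrite doubleS -mul_bin_diag.
have := mul_bin_down n.*2.+1 n; rewrite /= => ->.
by rewrite mulnA; congr (_ * _)%N; lia.
Qed.

(* With x = P * s - 2 * H = y + 1, T = S(x) and S = S(x - 2), this carries the
   congruence for x to x - 2: the quotient by P ^+ 2 is written in terms of
   quantities that are p-integral when P = p divides d. *)
Lemma descent_identity (F : numFieldType) (P s H c d q S T e : F) :
  let y := P * s - 2 * H - 1 in P != 0 -> 1 + H != 0 -> y != 0 ->
  y * ((y + 1) * T + 4 * y * S) = - 1 * d ^+ 2 * q ->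
  ((y - 1) * (2 * (2 * H + 1) * c / (1 + H)) * S + e * (2 * P * (s - 1)))
    / P ^+ 2 =
  (2 * s * e * (2 * (s - 1)) * y
   - 2 * (2 * H + 1) * (y - 1) * c * (d / P) ^+ 2 * q
   - 2 * (2 * H + 1) * (y - 1) * y
      * (((y + 1) * c * T - e * (2 * P * (s - 1))) / P ^+ 2))
    * (2^-1 * 2^-1 * (1 + H)^-1 * y^-1 ^+ 2).
Proof.
move=> y P0 H0 y0 E.
have -> : S = (- 1 * d ^+ 2 * q / y - (y + 1) * T) / (4 * y).
  by rewrite -E; field.
have -> : s = (y + 2 * H + 1) / P by rewrite /y; field.
by move: y y0 {E} => y y0; field; rewrite H0 y0 P0.
Qed.

(* Dispatches on the head symbol: rewriting with the rpred lemmas would unfold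
   definitions to find a sum or a product.  The change restores the predicate,
   which rpred leaves as a structure with fewer closure properties. *)
Ltac Zloc_closed p :=
  match goal with
  | H : is_true (in_mem ?x _) |- is_true (in_mem ?x _) => exact: H
  | |- is_true (in_mem ?x _) =>
    change (is_true (x \in Zloc p));
    lazymatch x with
    | _ + _ => apply: rpredD; Zloc_closed p
    | - _ => rewrite rpredN; Zloc_closed p
    | _ * _ => apply: rpredM; Zloc_closed p
    | _ ^+ _ => apply: rpredX; Zloc_closed p
    | _ *+ _ => exact: rpred_nat
    | 1 => exact: rpred1
    end
  end.

(** * Units and divisibility by p among the p-integral rationals *)

Section Localization.
Variables (p : nat) (p_prime : prime p).

Let p_neq0 : p%:R != 0 :> rat.
Proof. by rewrite pnatr_eq0 -lt0n prime_gt0. Qed.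

Lemma Zloc_frac x : x \in Zloc p ->
  exists n d : int, ~~ (p%:Z %| d)%Z /\ x = n%:~R / d%:~R.
Proof. by move=> xZ; exists (numq x), (denq x); rewrite divq_num_den. Qed.

Lemma dvdz_primeM (m n : int) :
  (p%:Z %| m * n)%Z = (p%:Z %| m)%Z || (p%:Z %| n)%Z.
Proof. by rewrite !dvdzE abszM Euclid_dvdM. Qed.

Lemma Zloc_int n : n%:~R \in Zloc p.
Proof. by rewrite unfold_in denq_int /= dvdzE /= dvdn1 neq_ltn prime_gt1 ?orbT. Qed.

Lemma Zloc_subring_closed : subring_closed (Zloc p).
Proof.
have ratr0 (d : int) : ~~ (p%:Z %| d)%Z -> d%:~R != 0 :> rat.
  by rewrite intr_eq0; apply: contraNneq => ->; apply: dvdz0.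
split=> [|x y|x y]; first exact: (Zloc_int 1).
- move=> /Zloc_frac[n [d [pd ->]]] /Zloc_frac[n' [d' [pd' ->]]].
  have -> : n%:~R / d%:~R - n'%:~R / d'%:~R
     = (n * d' - n' * d)%:~R / (d * d')%:~R :> rat.
    by rewrite rmorphB !rmorphM /=; field; rewrite !ratr0.
  by apply: dvd_denq_Zloc; rewrite // dvdz_primeM negb_or pd.
- move=> /Zloc_frac[n [d [pd ->]]] /Zloc_frac[n' [d' [pd' ->]]].
  rewrite mulf_div -!rmorphM.
  by apply: dvd_denq_Zloc; rewrite // dvdz_primeM negb_or pd.
Qed.

HB.instance Definition _ :=
  GRing.isSubringClosed.Build rat (Zloc p) Zloc_subring_closed.

(** Divisibility by [p] is encoded throughout as integrality of the quotient; this is congruence to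
    the residue 0. *)
Lemma Zloc_divp x : x \in Zloc p -> (x / p%:R \in Zloc p) = (p%:Z %| numq x)%Z.
Proof.
move=> xZ; have := congrZloc_num 0 p_prime xZ.
by rewrite /congrZloc mul0r !subr0.
Qed.

Lemma Zloc_inv x : x \in Zloc p -> x / p%:R \notin Zloc p -> x^-1 \in Zloc p.
Proof.
move=> xZ; rewrite Zloc_divp // => pNx.
rewrite -[x]divq_num_den invf_div; exact: dvd_denq_Zloc.
Qed.

Lemma Zloc_nat_divp n : (n%:R / p%:R \in Zloc p) = (p %| n)%N.
Proof.
rewrite Zloc_divp ?rpred_nat // -[n%:R]/((n%:Z)%:~R) numq_int.
by rewrite dvdzE.
Qed.

Lemma Zloc_inv_nat n : ~~ (p %| n)%N -> n%:R^-1 \in Zloc p.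
Proof. by move=> pNn; apply: Zloc_inv; rewrite ?rpred_nat ?Zloc_nat_divp. Qed.

(** Modulo [p] the element is [- n], hence a unit. *)
Lemma Zloc_inv_near_nat n x : x \in Zloc p -> ~~ (p %| n)%N ->
  (p%:R * x - n%:R)^-1 \in Zloc p.
Proof.
move=> xZ pNn; apply: Zloc_inv.
  by rewrite rpredB ?rpredM ?rpred_nat.
by rewrite mulrBl mulrAC divff // mul1r rpredBl // Zloc_nat_divp.
Qed.

Lemma near_nat_neq0 n x : x \in Zloc p -> ~~ (p %| n)%N ->
  p%:R * x - n%:R != 0.
Proof.
move=> xZ; apply: contraNneq => /eqP; rewrite subr_eq0 => /eqP xn.
by rewrite -Zloc_nat_divp -xn mulrAC divff // mul1r.
Qed.

Lemma prime_Ndvd_lt n : (0 < n < p)%N -> ~~ (p %| n)%N.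
Proof. by move=> np; rewrite gtnNdvd; lia. Qed.

Lemma prime_Ndvd_fact n : (n < p)%N -> ~~ (p %| n`!)%N.
Proof.
elim: n => [|n IHn] np; first by rewrite fact0 dvdn1 neq_ltn prime_gt1 ?orbT.
by rewrite factS Euclid_dvdM // negb_or prime_Ndvd_lt //= IHn // ltnW.
Qed.

(** * Binomial coefficients and alternating sums near multiples of p *)

Lemma gbin_Zloc x k : x \in Zloc p -> (k < p)%N -> gbin x k \in Zloc p.
Proof.
move=> xZ kp; rewrite rpredM ?Zloc_inv_nat ?prime_Ndvd_fact //.
by rewrite rpred_prod // => i _; rewrite rpredB ?rpred_nat.
Qed.

(** The factor [x - j] of the numerator supplies [p], and [k!] is a unit. *)
Lemma gbin_divp x j k : x \in Zloc p -> (j < k < p)%N ->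
  (x - j%:R) / p%:R \in Zloc p -> gbin x k / p%:R \in Zloc p.
Proof.
move=> xZ /andP[jk kp] xjZ; rewrite /gbin (bigD1 (Ordinal jk)) //= mulrAC.
rewrite rpredM ?Zloc_inv_nat ?prime_Ndvd_fact //.
by rewrite mulrAC rpredM ?rpred_prod // => i _; rewrite rpredB ?rpred_nat.
Qed.

Lemma zeil_cert_Zloc x y : x \in Zloc p -> y \in Zloc p ->
  zeil_cert x y \in Zloc p.
Proof. by move=> xZ yZ; rewrite /zeil_cert; Zloc_closed p. Qed.

Lemma gbin_pM_divp s k : s \in Zloc p -> (0 < k < p)%N ->
  gbin (p%:R * s) k / p%:R \in Zloc p.
Proof.
move=> sZ kp; apply: (@gbin_divp _ 0) => //.
  by rewrite rpredM ?rpred_nat.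
by rewrite subr0 mulrAC divff // mul1r.
Qed.

(** Modulo [p] only the summand [k = 0] survives. *)
Lemma alt_gbin_sum_pM s : s \in Zloc p ->
  (alt_gbin_sum p (p%:R * s) - 1) / p%:R \in Zloc p.
Proof.
move=> sZ; rewrite /alt_gbin_sum big_ltn ?prime_gt0 // gbin0 expr1n mul1r.
rewrite addrAC subrr add0r mulr_suml big_nat rpred_sum // => k kp.
have -> : gbin (p%:R * s) k ^+ 2 * (-1) ^+ k / p%:R =
  gbin (p%:R * s) k / p%:R * gbin (p%:R * s) k * (-1) ^+ k by ring.
have gZ : gbin (p%:R * s) k \in Zloc p.
  by rewrite gbin_Zloc ?rpredM ?rpred_nat //; lia.
have gpZ := gbin_pM_divp sZ kp; Zloc_closed p.
Qed.

(** By Pascal's rule two consecutive coefficients add up to [gbin (p%:R * s) k.+1], a multiple of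
    [p], so they are opposite modulo [p]. *)
Lemma gbin_pM_pred s k : s \in Zloc p -> (k < p)%N ->
  (gbin (p%:R * s - 1) k - (-1) ^+ k) / p%:R \in Zloc p.
Proof.
move=> sZ; elim: k => [|k IHk] kp; first by rewrite gbin0 subrr mul0r rpred0.
have -> : (gbin (p%:R * s - 1) k.+1 - (-1) ^+ k.+1) / p%:R =
  gbin (p%:R * s) k.+1 / p%:R - (gbin (p%:R * s - 1) k - (-1) ^+ k) / p%:R.
  by rewrite [gbin (p%:R * s) _]gbin_pascal exprS; ring.
by rewrite rpredB ?gbin_pM_divp ?IHk // ltnW.
Qed.

(** Start of the descent. At [x = p s] both the coefficient [x] and the value of [zeil_cert] are
    multiples of [p], so knowing the sum at [x] and the binomial modulo [p] gives the sum at [x - 2]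
    modulo [p ^ 2]. *)
Lemma alt_gbin_sum_neg2 s : odd p -> s \in Zloc p ->
  ((p%:R * s - 2) * 2 * alt_gbin_sum p (p%:R * s - 2) - 2 * p%:R * (s - 1))
    / p%:R ^+ 2 \in Zloc p.
Proof.
move=> p_odd sZ; have p_gt1 := prime_gt1 p_prime.
have psZ : p%:R * s \in Zloc p by rewrite rpredM ?rpred_nat.
have N1 : ~~ (p %| 1)%N by rewrite prime_Ndvd_lt.
have N2 : ~~ (p %| 2)%N by rewrite prime_Ndvd_lt //; lia.
have := zeilberger_recurrence p.-1 (p%:R * s).
rewrite prednK ?prime_gt0 // -[(-1) ^+ p]signr_odd p_odd expr1.
have := alt_gbin_sum_pM sZ; set A := _ / _ => AZ.
have -> : alt_gbin_sum p (p%:R * s) = 1 + p%:R * A.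
  by rewrite /A; field.
have pp : (p.-1 < p)%N by lia.
have := gbin_pM_pred sZ pp.
have -> : (-1) ^+ p.-1 = 1 :> rat.
  by rewrite -signr_odd (_ : odd p.-1 = false) ?expr0 //; lia.
set B := _ / _ => BZ.
have -> : gbin (p%:R * s - 1) p.-1 = 1 + p%:R * B.
  by rewrite /B; field.
set T := alt_gbin_sum p _; set P := p%:R : rat.
have x1 : P * s - 1 != 0 by apply: (@near_nat_neq0 1).
have x1Z : (P * s - 1)^-1 \in Zloc p by apply: (@Zloc_inv_near_nat 1).
have i2Z : 2^-1 \in Zloc p by apply: (@Zloc_inv_nat 2).
have PZ : P \in Zloc p by rewrite rpred_nat.
move=> E.
have ET : T = (- 1 * (1 + P * B) ^+ 2 * zeil_cert (P * s) P
     - (P * s - 1) * (P * s) * (1 + P * A)) / (4 * (P * s - 1) ^+ 2).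
  by rewrite -E; field.
(* [P * q1] is the value of [zeil_cert]; the numerator of [T] is
   [P * (2 - 2 * s + P * n1)]. *)
pose q1 := (3 * s - 2) + P * (- 2 + 6 * s - 5 * s ^+ 2).
pose n1 := - (2 * B + P * B ^+ 2) * q1 - (- 2 + 6 * s - 5 * s ^+ 2)
           - s ^+ 2 * (1 + P * A) + s * A.
have -> : ((P * s - 2) * 2 * T - 2 * P * (s - 1)) / P ^+ 2 =
  (2 * s * (2 - 2 * s) + 2 * (P * s - 2) * n1 - 8 * (s - 1) * s * (P * s - 2))
    * (2^-1 * 2^-1 * (P * s - 1)^-1 ^+ 2).
  rewrite ET /n1 /q1 /zeil_cert; field.
  by rewrite x1 p_neq0.
by rewrite /n1 /q1; Zloc_closed p.
Qed.

(** The denominators of the final congruence are cleared, so that a step of the descent only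
    multiplies by units. *)
Lemma alt_gbin_sum_neg_even h s : odd p -> s \in Zloc p -> (h.*2.+2 < p)%N ->
  ((p%:R * s - h.*2.+2%:R) * 'C(h.*2.+2, h.+1)%:R
     * alt_gbin_sum p (p%:R * s - h.*2.+2%:R)
   - (-1) ^+ h * (2 * p%:R * (s - 1))) / p%:R ^+ 2 \in Zloc p.
Proof.
move=> p_odd sZ; elim: h => [|h IHh] hp.
  by rewrite bin1 expr0 mul1r alt_gbin_sum_neg2.
have {IHh} := IHh (ltn_trans (ltnW (ltnSn _)) hp).
have N2 : ~~ (p %| 2)%N by apply: prime_Ndvd_lt; lia.
have Nh2 : ~~ (p %| h.+2)%N by apply: prime_Ndvd_lt; lia.
have Nh3 : ~~ (p %| h.*2.+3)%N by apply: prime_Ndvd_lt; lia.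
have h3p : (h.*2.+3 <= p)%N by lia.
(* For [j = p - (2 h + 3)] the factor [p s - (2 h + 3) - j] of the binomial in the recurrence is
   [p (s - 1)]; hence the square of that binomial vanishes modulo [p ^ 2]. *)
have root_lt : (p - h.*2.+3 < p.-1 < p)%N by lia.
set c := 'C(h.*2.+2, h.+1)%:R => WZ.
have := zeilberger_recurrence p.-1 (p%:R * s - h.*2.+2%:R).
rewrite prednK ?prime_gt0 // -[(-1) ^+ p]signr_odd p_odd expr1.
set P := p%:R in WZ *; set H : rat := h.+1%:R.
have xE : P * s - h.*2.+2%:R = P * s - 2 * H by rewrite /H -natrM mul2n doubleS.
have yE : P * s - 2 * H - 1 = P * s - h.*2.+3%:R.
  by rewrite -xE -[h.*2.+3%:R]natr1; ring.
have aE : P * s - h.+1.*2.+2%:R = P * s - 2 * H - 2.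
  by rewrite -xE doubleS -addn2 natrD; ring.
have PZ : P \in Zloc p by rewrite rpred_nat.
have HZ : H \in Zloc p by rewrite rpred_nat.
have cZ : c \in Zloc p by rewrite rpred_nat.
have i2Z : 2^-1 \in Zloc p by apply: Zloc_inv_nat N2.
have hZ : (1 + H)^-1 \in Zloc p by rewrite /H nat1r Zloc_inv_nat.
have h0 : 1 + H != 0 by rewrite /H nat1r pnatr_eq0.
have y0 : P * s - 2 * H - 1 != 0 by rewrite yE near_nat_neq0.
have yZ : (P * s - 2 * H - 1)^-1 \in Zloc p by rewrite yE Zloc_inv_near_nat.
have CE : 'C(h.+1.*2.+2, h.+2)%:R = 2 * (2 * H + 1) * c / (1 + H) :> rat.
  apply: (canRL (mulfK h0)).
  have -> : 2 * H + 1 = h.+1.*2.+1%:R by rewrite -[in RHS]natr1 -mul2n natrM.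
  by rewrite /c /H nat1r -!natrM mulnC -doubleS central_bin mulnA.
rewrite aE CE; rewrite xE in WZ *.
set d := gbin _ _; have dZ : d / P \in Zloc p.
  apply: (gbin_divp _ root_lt); first by rewrite yE rpredB ?rpredM ?rpred_nat.
  rewrite yE natrB // (_ : _ / _ = s - 1) ?rpredB ?rpred1 //.
  by rewrite -/P; field.
set q := zeil_cert _ _; have qZ : q \in Zloc p.
  by apply: zeil_cert_Zloc; Zloc_closed p.
set y := P * s - 2 * H - 1 in y0 yZ *.
have yZ' : y \in Zloc p by rewrite /y; Zloc_closed p.
have -> : P * s - 2 * H - 2 = y - 1 by rewrite /y; ring.
have yS : P * s - 2 * H = y + 1 by rewrite /y; ring.
rewrite yS => E; rewrite [(-1) ^+ h.+1]exprS mulN1r mulNr opprK.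
rewrite (descent_identity _ _ p_neq0 h0 y0 E) -/P -/y.
by rewrite yS in WZ; Zloc_closed p.
Qed.
End Localization.

(** * From the descent to the stated congruence *)

Theorem theorem3p1 (p : nat) (a : rat) (p_prime : prime p) (p_odd : odd p)
    (a_Zloc : a \in Zloc p) (res_odd : odd (residue p a)) :
  congrZloc p (p ^ 2)
    (\sum_(0 <= k < p) gbin a k ^+ 2 * (-1) ^+ k)
    ((-1) ^+ ((p - residue p a) %/ 2 - 1)
       * (2 * (a - (residue p a)%:R)
          / (a * 'C(p - residue p a, (p - residue p a) %/ 2)%:R))).
Proof.
have [rp ar _] := residueP p_prime a_Zloc.
move: res_odd rp ar; set r := residue p a => r_odd rp ar.
(* Both [p] and [r] are odd and [r < p], so the difference is even and positive. *)
have [h hE] : exists h, (p - r = h.*2.+2)%N.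
  by exists (p - r)./2.-1; lia.
have -> : ((p - r) %/ 2 = h.+1)%N by lia.
rewrite subn1 hE /=.
have p0 : p%:R != 0 :> rat by rewrite pnatr_eq0 -lt0n prime_gt0.
(* Chosen so that [a = p s - (p - r)] and [p (s - 1) = a - r]. *)
pose s := (a - r%:R) / p%:R + 1.
have sZ : s \in Zloc p by rewrite rpredD ?rpred1.
have hp : (h.*2.+2 < p)%N by lia.
have aE : p%:R * s - h.*2.+2%:R = a.
  by rewrite -hE natrB ?(ltnW rp) // /s; field.
have hN := prime_Ndvd_lt p_prime (n := h.*2.+2) hp.
have a0 : a != 0 by rewrite -aE near_nat_neq0.
have aV : a^-1 \in Zloc p by rewrite -aE Zloc_inv_near_nat.
(* The coefficient divides [(2 h + 2)!], which is prime to [p]. *)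
have CN : ~~ (p %| 'C(h.*2.+2, h.+1))%N.
  apply: contra (prime_Ndvd_fact p_prime hp) => pC.
  by rewrite -(@bin_fact _ h.+1) ?dvdn_mulr //; lia.
have C0 : 'C(h.*2.+2, h.+1)%:R != 0 :> rat.
  by rewrite pnatr_eq0 -lt0n bin_gt0; lia.
have := alt_gbin_sum_neg_even p_prime p_odd sZ hp.
rewrite aE /s addrK -/(alt_gbin_sum p a) /congrZloc natrX.
set C := 'C(_, _)%:R in C0 *; set S := alt_gbin_sum p a => E.
have CV : C^-1 \in Zloc p := Zloc_inv_nat p_prime CN.
(* The cleared congruence is divided by the units [a] and [C]. *)
rewrite (_ : _ / _ = (a * C * S - (-1) ^+ h
    * (2 * p%:R * ((a - r%:R) / p%:R))) / p%:R ^+ 2 * a^-1 * C^-1).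
  by Zloc_closed p.
by field; rewrite C0 a0 p0.
Qed.
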